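(* Let $G=(V,E)$ be a connected, locally finite infinite network with conductance function $c$ and base point $o\in V$, with energy Hilbert space $\mathscr{H}_E$, dipoles $(v_x)_{x\in V}$, and kernel $k^{(c)}(x,y)=\langle v_x,v_y\rangle_{\mathscr{H}_E}$. Then there is a metric $R^{(c)}$ on $V$, namely the resistance metric $R^{(c)}(x,y)=\Vert v_x-v_y\Vert_{\mathscr{H}_E}^2$, such that $$k^{(c)}(x,y)=\frac{R^{(c)}(o,x)+R^{(c)}(o,y)-R^{(c)}(x,y)}{2}$$ holds for all $(x,y)\in V\times V$.
   Context: Setting. $V$ is a countably infinite set, $E\subset V\times V\setminus(\text{diagonal})$ is symmetric, and $c:E\to(0,\infty)$ satisfies $c_{xy}=c_{yx}$. Each $x\in V$ has only finitely many neighbors (points $y$ with $(x,y)\in E$). A base point $o\in V$ is fixed, and $G$ is connected: for every $x\in V\setminus\{o\}$ there are edges $(x_i,x_{i+1})\in E$, $0\le i\le n-1$, with $x_0=o$, $x_n=x$. The energy Hilbert space $\mathscr{H}_E$ consists of all functions $f:V\to\mathbb{C}$ with $f(o)=0$ and $\|f\|_{\mathscr{H}_E}^2=\frac12\sum_{(x,y)\in E}c_{xy}|f(x)-f(y)|^2<\infty$, with inner product $\langle h,f\rangle_{\mathscr{H}_E}=\frac12\sum_{(x,y)\in E}c_{xy}(\overline{h(x)}-\overline{h(y)})(f(x)-f(y))$. For each $x\in V$ the dipole $v_x\in\mathscr{H}_E$ is the unique vector with $\langle v_x,f\rangle_{\mathscr{H}_E}=f(x)-f(o)$ for all $f\in\mathscr{H}_E$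 (so $v_o=0$). *)

(* Defs.v *)
From HB Require Import structures.
From mathcomp Require Import all_boot all_order all_algebra.
From mathcomp Require Import complex.
From mathcomp Require Import mathcomp_extra boolp classical_sets functions.
From mathcomp Require Import cardinality reals ereal constructive_ereal.
From mathcomp Require Import numfun esum.

Set Implicit Arguments.
Unset Strict Implicit.
Unset Printing Implicit Defensive.

Import Order.TTheory GRing.Theory Num.Theory.
Import Normc.

Local Open Scope classical_set_scope.
Local Open Scope ring_scope.

Section unordered_sums.
Context {R : realType} {T : choiceType}.

(* \esum is only meaningful for nonnegative terms; signed and complex families
   are summed through positive/negative and real/imaginary parts. These are the
   usual sums for absolutely summable families (otherwise the value is junk). *)
Definition rsum (D : set T) (a : T -> R) : R :=
  fine (esum D (EFin \o a)^\+ - esum D (EFin \o a)^\-)%E.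

Definition csum (D : set T) (a : T -> R[i]) : R[i] :=
  Complex (rsum D (fun t => complex.Re (a t)))
          (rsum D (fun t => complex.Im (a t))).

End unordered_sums.

Section network.
Context {R : realType} {V : countType}.

Definition edges (E : rel V) : set (V * V) := [set p | E p.1 p.2].

Definition locally_finite (E : rel V) :=
  forall x, finite_set [set y | E x y].

Definition connected_from (E : rel V) (o : V) :=
  forall x, x != o -> exists2 s : seq V, path E o s & last o s = x.

(* Conductances are total functions on V x V; values off E play no role. *)
Definition conductance (E : rel V) (c : V -> V -> R) :=
  (forall x y, E x y -> 0 < c x y) /\ (forall x y, E x y -> c x y = c y x).

Definition energy (E : rel V) (c : V -> V -> R) (f : V -> R[i]) : \bar R :=
  ((2^-1)%:E * \esum_(p in edges E)
     (c p.1 p.2 * normc (f p.1 - f p.2) ^+ 2)%:E)%E.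

Definition energy_space (E : rel V) (c : V -> V -> R) (o : V) :
    set (V -> R[i]) :=
  [set f | f o = 0 /\ (energy E c f < +oo)%E].

Definition energy_norm (E : rel V) (c : V -> V -> R) (f : V -> R[i]) : R :=
  Num.sqrt (fine (energy E c f)).

(* Conjugate-linear in the first argument. *)
Definition energy_inner (E : rel V) (c : V -> V -> R) (h f : V -> R[i]) : R[i] :=
  2^-1 * csum (edges E) (fun p =>
    real_complex R (c p.1 p.2)
      * (conjc (h p.1) - conjc (h p.2)) * (f p.1 - f p.2)).

Definition is_dipole (E : rel V) (c : V -> V -> R) (o x : V) (v : V -> R[i]) :=
  energy_space E c o v /\
  forall f, energy_space E c o f -> energy_inner E c v f = f x - f o.

(* The vector characterized by is_dipole; the default value 0 is returned only
   if there is no such vector. *)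
Definition dipole (E : rel V) (c : V -> V -> R) (o x : V) : V -> R[i] :=
  xget (fun=> 0) [set v | is_dipole E c o x v].

Definition energy_kernel (E : rel V) (c : V -> V -> R) (o x y : V) : R[i] :=
  energy_inner E c (dipole E c o x) (dipole E c o y).

Definition is_metric (d : V -> V -> R) :=
  [/\ forall x y, 0 <= d x y,
      forall x y, d x y = 0 <-> x = y,
      forall x y, d x y = d y x
    & forall x y z, d x z <= d x y + d y z].

End network.

(* Main.v *)
Require Import Defs.
From mathcomp Require Import all_boot all_order all_algebra.
From mathcomp Require Import complex ring lra.
From mathcomp Require Import finmap.
From mathcomp Require Import boolp classical_sets cardinality reals.
From mathcomp Require Import fsbigop constructive_ereal ereal numfun esum.
From mathcomp Require Import filter topology normedtype.

Import Order.TTheory GRing.Theory Num.Theory.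
Import numFieldNormedType.Exports.

Local Open Scope classical_set_scope.
Local Open Scope ring_scope.

(** The space of finite-energy functions modulo constants is a Hilbert space in
    which evaluation differences [f x - f o] are continuous, so dipoles exist
    by the Riesz representation theorem. Here the representing vectors are
    produced by the Dirichlet principle. For [x != o], minimize the energy over
    the real functions that vanish at [o] and equal 1 at [x]. Truncation to
    [0, 1] does not increase energy, so a minimizing sequence can be taken in
    the product of the segments [0, 1], which is compact, and the energy is
    lower semicontinuous for pointwise convergence
    ([exists_energy_minimizer]). The minimizer is orthogonal to every
    finite-energy function vanishing at [o] and [x]; divided by its own energy
    it is the dipole ([exists_real_dipole]). The energy vanishes only on
    constants because the network is connected, so dipoles are unique, and the
    complex dipoles are these real functions ([dipole_real]).

    For dipoles the energy form is [<v_x, v_y> = v_x(y)], which is real and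
    symmetric, and expanding [R(x, y) = ||v_x - v_y||^2] gives the formula for
    the kernel because [v_o = 0].

    Among the metric axioms, separation follows by testing [v_x - v_y] against
    the indicator function of [x], which has finite energy by local finiteness
    ([real_dipole_dist_eq0]). For the triangle inequality, put
    [a = v_x - v_y] and [b = v_z - v_y]; then
    [R(x, z) = R(x, y) + R(y, z) - 2 <a, b>], so it suffices that
    [<a, b> = a(z) - a(y) >= 0]. This is a minimum principle: [v_x - v_y] is
    smallest at [y] ([real_dipole_sub_ge]). Indeed, raising this function to its
    value at [y] wherever it is below that value does not increase its energy,
    while its pairing with the dipole difference is unchanged. *)

(** * Linearity of unordered sums *)

Section unordered_sum_theory.
Context {R : realType} {T : choiceType}.
Implicit Types (D : set T) (a b : T -> R) (k : R).

(** Absolute summability; on such families [rsum] is the usual sum. *)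
Definition rsummable D a := summable D (EFin \o a).

Lemma eq_rsum D a b : (forall t, D t -> a t = b t) -> rsum D a = rsum D b.
Proof.
move=> eqab; rewrite /rsum; congr (fine (_ - _)%E); apply: eq_esum => t Dt.
  by rewrite !funeposE /= eqab.
by rewrite !funenegE /= eqab.
Qed.

Lemma rsummable_ge0E D a : (forall t, D t -> 0 <= a t) ->
  rsummable D a = (\esum_(t in D) (a t)%:E < +oo)%E.
Proof.
move=> a0; rewrite /rsummable /summable; congr (_ < _)%E.
by apply: eq_esum => t Dt; rewrite /= ger0_norm // a0.
Qed.

Lemma le_rsummable D a b : (forall t, D t -> `|a t| <= b t) ->
  rsummable D b -> rsummable D a.
Proof.
move=> ab; apply: le_lt_trans; apply: le_esum => t Dt.
by rewrite /= lee_fin (le_trans (ab t Dt)) // ler_norm.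
Qed.

Lemma eq_rsummable D a b :
  (forall t, D t -> a t = b t) -> rsummable D a -> rsummable D b.
Proof.
move=> eqab; rewrite /rsummable /summable; apply: le_lt_trans.
by apply: le_esum => t Dt; rewrite /= eqab.
Qed.

Lemma rsummable_norm D a : rsummable D a -> rsummable D (fun t => `|a t|).
Proof.
by apply: le_lt_trans; apply: le_esum => t Dt; rewrite /= normr_id.
Qed.

Lemma rsummableD D a b :
  rsummable D a -> rsummable D b -> rsummable D (fun t => a t + b t).
Proof. exact: summableD. Qed.

Lemma ge0_esum_le D a k :
  (forall F : {fset T}, [set` F] `<=` D -> \sum_(t <- F) a t <= k) ->
  (\esum_(t in D) (a t)%:E <= k%:E)%E.
Proof.
move=> le_k; apply: ge_ereal_sup => _ [X [finX XD] <-].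
rewrite fsumEFin // lee_fin fsbig_finite //; apply: le_k.
by rewrite fset_setK.
Qed.

Lemma esum_ge_fset D a (F : {fset T}) : [set` F] `<=` D ->
  ((\sum_(t <- F) a t)%:E <= \esum_(t in D) (a t)%:E)%E.
Proof.
move=> FD; apply: ereal_sup_ubound; exists [set` F]; first by split.
by rewrite fsumEFin // fsbig_finite // set_fsetK.
Qed.

Lemma rsum_ge0E D a : (forall t, D t -> 0 <= a t) ->
  rsum D a = fine (\esum_(t in D) (a t)%:E).
Proof.
move=> a0; rewrite /rsum; congr fine; rewrite [X in (_ - X)%E]esum1 ?sube0.
  apply: eq_esum => t Dt; rewrite funeposE; apply/max_idPl.
  by rewrite lee_fin a0.
move=> t Dt; rewrite funenegE; apply/max_idPr.
by rewrite /= lee_fin oppr_le0 a0.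
Qed.

Lemma rsumE D a : (forall t, D t -> 0 <= a t) -> rsummable D a ->
  (rsum D a)%:E = (\esum_(t in D) (a t)%:E)%E.
Proof.
move=> a0; rewrite rsummable_ge0E // rsum_ge0E // => sa; rewrite fineK //.
by rewrite ge0_fin_numE // esum_ge0 // => t Dt; rewrite lee_fin a0.
Qed.

Lemma rsum_ge0 D a : (forall t, D t -> 0 <= a t) -> 0 <= rsum D a.
Proof.
move=> a0; rewrite rsum_ge0E //; apply: fine_ge0.
by apply: esum_ge0 => t Dt; rewrite lee_fin a0.
Qed.

Lemma rsum_ge_fset D a (F : {fset T}) : (forall t, D t -> 0 <= a t) ->
  rsummable D a -> [set` F] `<=` D -> \sum_(t <- F) a t <= rsum D a.
Proof. by move=> a0 sa FD; rewrite -lee_fin rsumE //; exact: esum_ge_fset. Qed.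

Lemma rsum_fset_le D a k : (forall t, D t -> 0 <= a t) ->
  (forall F : {fset T}, [set` F] `<=` D -> \sum_(t <- F) a t <= k) ->
  rsummable D a /\ rsum D a <= k.
Proof.
move=> a0 /ge0_esum_le ak.
have sa : rsummable D a by rewrite rsummable_ge0E // (le_lt_trans ak) ?ltry.
by split=> //; rewrite -lee_fin rsumE.
Qed.

Lemma rsum_ge0D D a b :
  (forall t, D t -> 0 <= a t) -> (forall t, D t -> 0 <= b t) ->
  rsummable D a -> rsummable D b ->
  rsum D (fun t => a t + b t) = rsum D a + rsum D b.
Proof.
move=> a0 b0 sa sb; apply: EFin_inj; rewrite EFinD !rsumE //.
- by rewrite -esumD // => t Dt; rewrite lee_fin ?a0 ?b0.
- by move=> t Dt; rewrite addr_ge0 ?a0 ?b0.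
- exact: rsummableD.
Qed.

Lemma rsum_ge0B D a b :
  (forall t, D t -> 0 <= a t) -> (forall t, D t -> 0 <= b t) ->
  rsummable D a -> rsummable D b ->
  rsum D (fun t => a t - b t) = rsum D a - rsum D b.
Proof.
move=> a0 b0 sa sb.
have aE0 t : D t -> (0 <= (a t)%:E)%E by rewrite lee_fin; apply: a0.
have bE0 t : D t -> (0 <= (b t)%:E)%E by rewrite lee_fin; apply: b0.
have H := esumB sa sb aE0 bE0.
by rewrite {1}/rsum; move: H => /= ->; rewrite -!rsumE.
Qed.

(** Additivity is reduced to nonnegative families by writing each term [a t] as
    [(|a t| + a t) - |a t|]. *)
Lemma rsumD D a b : rsummable D a -> rsummable D b ->
  rsum D (fun t => a t + b t) = rsum D a + rsum D b.
Proof.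
move=> sa sb.
have sna := rsummable_norm _ _ sa; have snb := rsummable_norm _ _ sb.
have p0 (f : T -> R) t : D t -> 0 <= `|f t| + f t.
  by move=> _; have := ler_norm (- f t); rewrite normrN; lra.
have rE f : rsummable D f ->
    rsum D f = rsum D (fun t => `|f t| + f t) - rsum D (fun t => `|f t|).
  move=> sf; have snf := rsummable_norm _ _ sf.
  rewrite -rsum_ge0B //; [|exact: p0|exact: rsummableD].
  by apply: eq_rsum => t _; rewrite addrAC subrr add0r.
rewrite [rsum D a]rE // [rsum D b]rE // addrACA -opprD.
rewrite -rsum_ge0D; [|exact: p0|exact: p0|exact: rsummableD..].
rewrite -[X in _ - X]rsum_ge0D // -rsum_ge0B.
- by apply: eq_rsum => t _; lra.
- by move=> t Dt; rewrite addr_ge0 // p0.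
- by move=> t Dt; rewrite addr_ge0.
- by apply: rsummableD; apply: rsummableD.
- exact: rsummableD.
Qed.

Lemma rsum_ge0Z D k a : 0 <= k -> (forall t, D t -> 0 <= a t) ->
  rsummable D a ->
  rsummable D (fun t => k * a t) /\ rsum D (fun t => k * a t) = k * rsum D a.
Proof.
have le_kM l b : 0 <= l -> (forall t, D t -> 0 <= b t) -> rsummable D b ->
    rsummable D (fun t => l * b t) /\ rsum D (fun t => l * b t) <= l * rsum D b.
  move=> l0 b0 sb; apply: rsum_fset_le => [t Dt|F FD].
    by rewrite mulr_ge0 ?b0.
  by rewrite -mulr_sumr ler_wpM2l // rsum_ge_fset.
move=> k0 a0 sa; have [ska leka] := le_kM k a k0 a0 sa; split=> //.
move: k0; rewrite le_eqVlt => /predU1P[k0|k0].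
  rewrite -k0 mul0r (eq_rsum _ _ (fun=> 0)); last by move=> t _; rewrite mul0r.
  by rewrite rsum_ge0E // esum1.
apply/eqP; rewrite eq_le leka /= -ler_pdivlMl //.
have [||//|_] := le_kM k^-1 (fun t => k * a t).
- by rewrite invr_ge0 ltW.
- by move=> t Dt; rewrite mulr_ge0 ?a0 // ltW.
apply: le_trans; rewrite (eq_rsum _ _ a) // => t _.
by rewrite mulKf // gt_eqF.
Qed.

Lemma rsummableZ D k a : rsummable D a -> rsummable D (fun t => k * a t).
Proof.
move=> sa; have [//||s _] := rsum_ge0Z D `|k| (fun t => `|a t|) (normr_ge0 k).
  exact: rsummable_norm.
by apply: le_rsummable s => t _; rewrite normrM.
Qed.

Lemma rsumN D a : rsummable D a -> rsum D (fun t => - a t) = - rsum D a.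
Proof.
move=> sa; have sN : rsummable D (fun t => - a t).
  by apply: eq_rsummable (rsummableZ D (-1) a sa) => t _; rewrite mulN1r.
apply/eqP; rewrite -addr_eq0 -rsumD // (eq_rsum _ _ (fun=> 0)).
  by rewrite rsum_ge0E // esum1.
by move=> t _; rewrite addNr.
Qed.

Lemma rsumZ D k a : rsummable D a -> rsum D (fun t => k * a t) = k * rsum D a.
Proof.
move=> sa; wlog k0 : k / 0 <= k => [wl|].
  have [/wl//|k0] := leP 0 k.
  rewrite (eq_rsum _ _ (fun t => - ((- k) * a t))); last first.
    by move=> t _; rewrite mulNr opprK.
  by rewrite rsumN ?wl ?oppr_ge0 ?ltW // ?mulNr ?opprK //; exact: rsummableZ.
have sna := rsummable_norm _ _ sa.
have p0 t : D t -> 0 <= `|a t| + a t.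
  by move=> _; have := ler_norm (- a t); rewrite normrN; lra.
have spa := rsummableD _ _ _ sna sa.
have [s1 e1] := rsum_ge0Z D k _ k0 p0 spa.
have [//|s2 e2] := rsum_ge0Z D k (fun t => `|a t|) k0 _ sna.
rewrite (eq_rsum _ _ (fun t => k * (`|a t| + a t) + - (k * `|a t|))).
  rewrite rsumD ?rsumN ?e1 ?e2 ?rsumD //; first by ring.
  by apply: eq_rsummable (rsummableZ D (-1) _ s2) => t _; rewrite mulN1r.
by move=> t _; ring.
Qed.

Lemma finite_support_rsummable D (S : set T) a : finite_set S ->
  (forall t, D t -> ~ S t -> a t = 0) -> rsummable D a.
Proof.
move=> finS a0; rewrite /rsummable /summable (esumID S) //=.
rewrite [X in (_ + X)%E]esum1 ?adde0; last first.
  by move=> t [Dt St]; rewrite a0 // normr0.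
have finDS : finite_set (D `&` S) by apply: finite_setIr.
by rewrite esum_fset // fsumEFin // ltry.
Qed.

Lemma ge0_le_rsum D a b : (forall t, D t -> 0 <= a t) ->
  (forall t, D t -> a t <= b t) -> rsummable D b ->
  rsummable D a /\ rsum D a <= rsum D b.
Proof.
move=> a0 ab sb; apply: rsum_fset_le => // F FD.
apply: le_trans (rsum_ge_fset D b F _ sb FD); last first.
  by move=> t Dt; rewrite (le_trans (a0 t Dt)) // ab.
by rewrite big_seq [leRHS]big_seq; apply: ler_sum => t tF; apply/ab/FD.
Qed.

End unordered_sum_theory.

(** * The energy form on real functions *)

Section energy_form.
Context {R : realType} {V : countType} (E : rel V) (c : V -> V -> R) (o : V).
Hypothesis c_conductance : conductance E c.
Hypothesis E_locally_finite : locally_finite E.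
Hypothesis E_symmetric : symmetric E.
Hypothesis E_connected : connected_from E o.
Implicit Types (f g h u v w : V -> R) (x y z : V) (k t : R).

Let c_gt0 p : edges E p -> 0 < c p.1 p.2.
Proof. exact: c_conductance.1. Qed.

(** The contribution of the oriented edge [p] to twice the energy inner product
    of two real functions. *)
Definition edge_form f g (p : V * V) : R :=
  c p.1 p.2 * (f p.1 - f p.2) * (g p.1 - g p.2).

(** Real functions of finite energy, with no normalization at the base point, so
    that constants and truncations are allowed. *)
Definition finite_energy f := rsummable (edges E) (edge_form f f).

(** The energy inner product on real functions. *)
Definition energy_form f g : R := 2^-1 * rsum (edges E) (edge_form f g).

Lemma edge_form_ge0 f p : edges E p -> 0 <= edge_form f f p.
Proof.
by move=> Ep; rewrite /edge_form -mulrA -expr2 mulr_ge0 ?sqr_ge0 // ltW ?c_gt0.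
Qed.

Lemma rsummable_edge_form f g : finite_energy f -> finite_energy g ->
  rsummable (edges E) (edge_form f g).
Proof.
move=> ff fg; apply: le_rsummable (rsummableD _ _ _ ff fg) => p Ep.
rewrite /edge_form; have := c_gt0 _ Ep; move: (c _ _) => k k0.
rewrite -!mulrA !normrM (gtr0_norm k0) -mulrDr ler_wpM2l ?(ltW k0) //.
set a := f _ - _; set b := g _ - _.
rewrite -normrM ler_norml; apply/andP; split; nra.
Qed.

Lemma finite_energyD f g : finite_energy f -> finite_energy g ->
  finite_energy (fun x => f x + g x).
Proof.
move=> ff fg; have sfg := rsummable_edge_form _ _ ff fg.
have := rsummableD _ _ _ (rsummableD _ _ _ ff fg) (rsummableD _ _ _ sfg sfg).
by apply: eq_rsummable => p _; rewrite /edge_form; ring.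
Qed.

Lemma finite_energyZ k f : finite_energy f -> finite_energy (fun x => k * f x).
Proof.
move=> ff; have := rsummableZ _ (k * k) _ ff.
by apply: eq_rsummable => p _; rewrite /edge_form; ring.
Qed.

Lemma finite_energyB f g : finite_energy f -> finite_energy g ->
  finite_energy (fun x => f x - g x).
Proof.
move=> ff /(finite_energyZ (-1)) fg; have := finite_energyD _ _ ff fg.
by apply: eq_rsummable => p _; rewrite /edge_form; ring.
Qed.

Lemma eq_energy_form f f' g g' : (forall x y, f x - f y = f' x - f' y) ->
  (forall x y, g x - g y = g' x - g' y) -> energy_form f g = energy_form f' g'.
Proof.
move=> ef eg; congr (_ * _); apply: eq_rsum => p _.
by rewrite /edge_form ef eg.
Qed.

Lemma energy_formC f g : energy_form f g = energy_form g f.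
Proof.
by congr (_ * _); apply: eq_rsum => p _; rewrite /edge_form; ring.
Qed.

Lemma energy_formDr f g h : finite_energy f -> finite_energy g ->
  finite_energy h ->
  energy_form f (fun x => g x + h x) = energy_form f g + energy_form f h.
Proof.
move=> ff fg fh; rewrite /energy_form -mulrDr -rsumD; first last.
- exact: rsummable_edge_form.
- exact: rsummable_edge_form.
by congr (_ * _); apply: eq_rsum => p _; rewrite /edge_form; ring.
Qed.

Lemma energy_formZr k f g : finite_energy f -> finite_energy g ->
  energy_form f (fun x => k * g x) = k * energy_form f g.
Proof.
move=> ff fg; rewrite /energy_form mulrCA; congr (_ * _).
by rewrite -rsumZ; [apply: eq_rsum => p _; rewrite /edge_form; ring|
                    exact: rsummable_edge_form].
Qed.

Lemma energy_formBr f g h : finite_energy f -> finite_energy g ->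
  finite_energy h ->
  energy_form f (fun x => g x - h x) = energy_form f g - energy_form f h.
Proof.
move=> ff fg fh; rewrite -[- energy_form f h]mulN1r -energy_formZr //.
rewrite -energy_formDr //; last exact: finite_energyZ.
by apply: eq_energy_form => // x y; ring.
Qed.

Lemma energy_form_subE f g : finite_energy f -> finite_energy g ->
  energy_form (fun x => f x - g x) (fun x => f x - g x) =
  energy_form f f + energy_form g g - 2 * energy_form f g.
Proof.
move=> ff fg; have fB := finite_energyB _ _ ff fg.
rewrite energy_formBr // (energy_formC _ f) (energy_formC _ g).
by rewrite !energy_formBr // (energy_formC g f); ring.
Qed.

Lemma energy_form_ge0 f : 0 <= energy_form f f.
Proof.
by rewrite mulr_ge0 ?invr_ge0 // rsum_ge0 // => p; apply: edge_form_ge0.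
Qed.

(** The energy vanishes only on constants, since the network is connected. *)
Lemma energy_form_eq0 f : finite_energy f -> energy_form f f = 0 ->
  forall x y, f x = f y.
Proof.
move=> ff /eqP; rewrite mulf_eq0 invr_eq0 pnatr_eq0 /= => /eqP f0.
have fE x y : E x y -> f x = f y.
  move=> Exy; have Ep : edges E (x, y) := Exy.
  have : edge_form f f (x, y) <= 0.
    have := rsum_ge_fset (edges E) (edge_form f f) [fset (x, y)]%fset.
    rewrite big_seq_fset1 f0; apply=> //; first exact: edge_form_ge0.
    by move=> p /=; rewrite inE => /eqP ->.
  rewrite /edge_form -mulrA pmulr_rle0 ?c_gt0 // -expr2 => le0.
  by apply/eqP; rewrite -subr_eq0 -sqrf_eq0 eq_le le0 sqr_ge0.
suff fo x : f x = f o by move=> x y; rewrite !fo.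
have [->//|/E_connected[s]] := eqVneq x o.
elim: s o => [|y s IHs] z /= => [_ ->//|/andP[Ezy ps] ls].
by rewrite (IHs y) // -(fE _ _ Ezy).
Qed.

(** The Markov property: normal contractions do not increase the energy. *)
Lemma contraction_energy_form f g : finite_energy f ->
  (forall x y, `|g x - g y| <= `|f x - f y|) ->
  finite_energy g /\ energy_form g g <= energy_form f f.
Proof.
move=> ff gf; have [p|p Ep|//|fg le_gf] :=
  @ge0_le_rsum _ _ (edges E) (edge_form g g) (edge_form f f).
- exact: edge_form_ge0.
- rewrite /edge_form -!mulrA -!expr2 ler_wpM2l ?(ltW (c_gt0 _ Ep)) //.
  rewrite -(real_normK (num_real (f p.1 - f p.2))).
  rewrite -(real_normK (num_real (g p.1 - g p.2))).
  by apply: lerXn2r; rewrite ?nnegrE.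
- by split=> //; rewrite ler_wpM2l // invr_ge0.
Qed.

Lemma finite_energy_delta x : finite_energy (fun y => (y == x)%:R).
Proof.
pose S := [set (x, y) | y in [set y | E x y]] `|`
          [set (y, x) | y in [set y | E x y]].
apply: (@finite_support_rsummable _ _ _ S).
  by rewrite finite_setU; split; apply: finite_image; exact: E_locally_finite.
move=> [y z] /= Eyz nS; rewrite /edge_form /=.
case: eqVneq => [yx|_]; first by case: nS; left; exists z; rewrite /= -?yx.
case: eqVneq => [zx|_]; last by rewrite !subrr !mulr0.
by case: nS; right; exists y; rewrite /= -?zx // E_symmetric.
Qed.

(** * Existence of dipoles by the Dirichlet principle *)

(** Truncation of a real number to the unit interval. *)
Definition clamp (a : R) : R := Num.max 0 (Num.min a 1).

Lemma clamp_itv a : 0 <= clamp a <= 1.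
Proof.
rewrite /clamp; case: (leP a 1) => ?; first by case: (leP 0 a) => ?; lra.
by rewrite (max_r ler01) ler01 lexx.
Qed.

Lemma clamp_contraction a b : `|clamp a - clamp b| <= `|a - b|.
Proof.
wlog ab : a b / b <= a => [wl|].
  by have [/wl//|/ltW/wl] := leP b a; rewrite distrC (distrC b).
rewrite [leRHS]ger0_norm ?subr_ge0 // ler_norml /clamp.
by case: (leP a 1) => ?; case: (leP b 1) => ?; rewrite ?(max_r ler01);
  try (case: (leP 0 a) => ?); try (case: (leP 0 b) => ?); lra.
Qed.

Lemma cvg_edge_form_sum (G : set_system (V -> R)) (GF : Filter G) u
    (s : seq (V * V)) : (forall x, f x @[f --> G] --> u x) ->
  \sum_(p <- s) edge_form f f p @[f --> G] --> \sum_(p <- s) edge_form u u p.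
Proof.
move=> Gu; elim: s => [|p s IHs].
  by rewrite big_nil; under eq_fun do rewrite big_nil; exact: cvg_cst.
rewrite big_cons; under eq_fun do rewrite big_cons.
apply: cvgD => //; rewrite /edge_form.
by apply: cvgM; [apply: cvgM; [exact: cvg_cst|exact: cvgB]|exact: cvgB].
Qed.

(** The first-order condition at the minimum [t = 0] of a quadratic function. *)
Lemma linear_term_eq0 (b q : R) : 0 <= q ->
  (forall t, 0 <= t ^+ 2 * q - 2 * t * b) -> b = 0.
Proof.
(* The minimizer is b / q; q + 1 replaces q to avoid dividing by 0. *)
move=> q0 /(_ (b / (q + 1))).
have q1 : 0 < q + 1 by lra.
have -> : (b / (q + 1)) ^+ 2 * q - 2 * (b / (q + 1)) * b =
          - (b ^+ 2 * ((q + 2) / (q + 1) ^+ 2)) by field; rewrite gt_eqF.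
have r0 : 0 < (q + 2) / (q + 1) ^+ 2 by rewrite divr_gt0 ?exprn_gt0 //; lra.
rewrite oppr_ge0 pmulr_lle0 // => b0.
by apply/eqP; rewrite -sqrf_eq0 eq_le b0 sqr_ge0.
Qed.

(** The function of least energy with value 0 at [o] and 1 at [x]. It is the
    limit, along an ultrafilter, of a minimizing sequence with values in the
    unit interval. *)
Lemma exists_energy_minimizer x : x != o ->
  exists u, [/\ finite_energy u, u o = 0, u x = 1 &
    forall f, finite_energy f -> f o = 0 -> f x = 1 ->
      energy_form u u <= energy_form f f].
Proof.
move=> xo.
pose A := [set f | [/\ finite_energy f, f o = 0 & f x = 1]].
pose S := [set energy_form f f | f in A].
have A0 : A (fun y => (y == x)%:R).
  split; rewrite ?eqxx //; first exact: finite_energy_delta.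
  by rewrite eq_sym (negbTE xo).
have infS : has_inf S.
  pose d y : R := (y == x)%:R.
  split; first by exists (energy_form d d); exists d.
  by exists 0 => _ [f _ <-]; exact: energy_form_ge0.
have /choice[f_ f_P] : forall n : nat, exists f,
    [/\ A f, forall y, 0 <= f y <= 1 & energy_form f f < inf S + n.+1%:R^-1].
  move=> n; have [|_ [f [ff fo fx] <-] flt] :=
    inf_adherent _ infS (eps := n.+1%:R^-1).
    by rewrite invr_gt0.
  have [|fg gf] := contraction_energy_form f (clamp \o f) ff.
    by move=> y z; exact: clamp_contraction.
  exists (clamp \o f); split; last exact: le_lt_trans gf flt.
    split=> //=; rewrite ?fo ?fx /clamp; first by rewrite minElt ltr01 maxxx.
    by rewrite minxx maxElt ltr01.
  by move=> y; exact: clamp_itv.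
pose F := f_ @ \oo.
have FF : ProperFilter F by exact: fmap_proper_filter.
have [G [GU FG]] := @ultraFilterLemma _ F FF.
have cpt : compact [set f : prod_topology (fun _ : V => R) |
                    forall y, [set` `[0, 1]] (f y)].
  apply: (@tychonoff V (fun=> R) (fun=> [set` `[0, 1]])) => y.
  exact: segment_compact.
(* The set of functions with values in [0, 1] is compact for pointwise
   convergence, so the ultrafilter G, refining the sequence, has a limit u. *)
move: cpt; rewrite compact_ultra => /(_ G GU)[|u [u01 Gu]].
  apply: FG; exists 0%N => // n _ y /=; rewrite in_itv /=.
  by have [_ ->] := f_P n.
have {}Gu y : f y @[f --> G] --> u y.
  exact: (cvg_comp _ _ Gu (@proj_continuous V (fun=> R) y u)).
have GA (P : set (V -> R)) : (forall n, P (f_ n)) -> G P.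
  by move=> Pf; apply: FG; exists 0%N => // n _; exact: Pf.
have uo : u o = 0.
  apply/eqP; rewrite eq_le; apply/andP; split.
    by apply: cvgr_to_le (Gu o) _; apply: GA => n; have [[_ -> _]] := f_P n.
  by apply: cvgr_to_ge (Gu o) _; apply: GA => n; have [[_ -> _]] := f_P n.
have ux : u x = 1.
  apply/eqP; rewrite eq_le; apply/andP; split.
    by apply: cvgr_to_le (Gu x) _; apply: GA => n; have [[_ _ ->]] := f_P n.
  by apply: cvgr_to_ge (Gu x) _; apply: GA => n; have [[_ _ ->]] := f_P n.
(* A sum of edge contributions of u over finitely many edges is the limit along
   G of the same sums for f_ n, which are eventually at most 2 (inf S + e). *)
have [||fu ule] := rsum_fset_le (edges E) (edge_form u u) (2 * inf S).
- by move=> p; exact: edge_form_ge0.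
- move=> D DE; rewrite -ler_pdivrMl //; apply/ler_addgt0Pr => e e0.
  rewrite ler_pdivrMl //; apply: cvgr_to_le (cvg_edge_form_sum G _ u D Gu) _.
  apply: FG.
  change (\forall n \near \oo,
    \sum_(p <- D) edge_form (f_ n) (f_ n) p <= 2 * (inf S + e)).
  near=> n.
  have [[ff _ _] _ flt] := f_P n.
  rewrite -ler_pdivrMl //; apply: le_trans (_ : energy_form (f_ n) (f_ n) <= _).
    rewrite ler_pM2l ?invr_gt0 //; apply: rsum_ge_fset => // p.
    exact: edge_form_ge0.
  apply: le_trans (ltW flt) _; rewrite lerD2l ltW //.
  by near: n; exact: near_infty_natSinv_lt (PosNum e0).
exists u; split=> // f ff fo fx.
apply: le_trans (_ : inf S <= _); first by rewrite ler_pdivrMl.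
by apply: ge_inf; [exact: infS.2|exists f].
Unshelve. all: by end_near.
Qed.

(** Real-valued dipoles, characterized by testing against all real functions of
    finite energy, normalized or not; subtracting a constant changes neither
    side of the identity. *)
Definition real_dipole x v :=
  [/\ finite_energy v, v o = 0 &
    forall f, finite_energy f -> energy_form v f = f x - f o].

Lemma exists_real_dipole x : exists v, real_dipole x v.
Proof.
have [->|xo] := eqVneq x o.
  exists (fun=> 0); split=> //.
    apply: (@finite_support_rsummable _ _ _ set0) => // p _ _.
    by rewrite /edge_form; ring.
  move=> f ff; rewrite subrr /energy_form (eq_rsum _ _ (fun=> 0)).
    by rewrite rsum_ge0E // esum1 // mulr0.
  by move=> p _; rewrite /edge_form; ring.
have [u [fu uo ux umin]] := exists_energy_minimizer x xo.
have q0 : 0 < energy_form u u.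
  rewrite lt_neqAle energy_form_ge0 andbT eq_sym; apply/eqP.
  move=> /(energy_form_eq0 _ fu) /(_ o x) /eqP.
  by rewrite uo ux eq_sym oner_eq0.
have u_orth h : finite_energy h -> h o = 0 -> h x = 0 -> energy_form u h = 0.
  move=> fh ho hx; apply: (linear_term_eq0 _ _ (energy_form_ge0 h)) => t.
  have fth := finite_energyZ t h fh.
  have thE : energy_form (fun y => t * h y) (fun y => t * h y) =
             t ^+ 2 * energy_form h h.
    by rewrite energy_formZr // (energy_formC _ h) energy_formZr // mulrA.
  have := umin (fun y => u y - t * h y) (finite_energyB _ _ fu fth).
  rewrite uo ux ho hx mulr0 !subr0 => /(_ erefl erefl).
  by rewrite energy_form_subE // thE energy_formZr // => ?; lra.
exists (fun y => (energy_form u u)^-1 * u y); split.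
- exact: finite_energyZ.
- by rewrite uo mulr0.
move=> f ff; rewrite energy_formC energy_formZr // energy_formC.
(* Up to the constant f o, f is (f x - f o) u plus a function that vanishes at
   o and x. *)
have fxu := finite_energyZ (f x - f o) u fu.
have fh := finite_energyB _ _ ff fxu.
have fco : finite_energy (fun y => (f y - (f x - f o) * u y) - f o).
  by apply: eq_rsummable fh => p _; rewrite /edge_form; ring.
have := u_orth _ fco; rewrite uo ux mulr0 mulr1 => /(_ _ _).
rewrite (eq_energy_form u u _ (fun y => f y - (f x - f o) * u y)) //;
  last first.
  by move=> y z; ring.
rewrite energy_formBr // energy_formZr // => uf0.
have {uf0}/eqP : energy_form u f - (f x - f o) * energy_form u u = 0.
  by apply: uf0; ring.
by rewrite subr_eq0 => /eqP ->; rewrite mulrC mulfK // gt_eqF.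
Qed.

(** * Dipole differences and the resistance metric *)

Lemma energy_form_subC f g :
  energy_form (fun x => f x - g x) (fun x => f x - g x) =
  energy_form (fun x => g x - f x) (fun x => g x - f x).
Proof. by congr (_ * _); apply: eq_rsum => p _; rewrite /edge_form; ring. Qed.

Lemma real_dipole_formB x y vx vy f : real_dipole x vx -> real_dipole y vy ->
  finite_energy f -> energy_form (fun z => vx z - vy z) f = f x - f y.
Proof.
move=> [fx _ vxE] [fy _ vyE] ff.
by rewrite energy_formC energy_formBr // !(energy_formC f) vxE // vyE //; ring.
Qed.

Lemma real_dipole_uniq x v w : real_dipole x v -> real_dipole x w -> v = w.
Proof.
move=> dv dw; have [fv vo _] := dv; have [fw wo _] := dw.
have fvw := finite_energyB _ _ fv fw.
have : energy_form (fun z => v z - w z) (fun z => v z - w z) = 0.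
  by rewrite (real_dipole_formB x x) // subrr.
move=> /(energy_form_eq0 _ fvw) vw; apply/funext => z.
by apply/eqP; rewrite -subr_eq0 (vw z o) vo wo subrr.
Qed.

(** Minimum principle: [v_x - v_y] attains its minimum at [y]. *)
Lemma real_dipole_sub_ge x y vx vy z : real_dipole x vx -> real_dipole y vy ->
  vx y - vy y <= vx z - vy z.
Proof.
move=> dx dy; have [fx _ _] := dx; have [fy _ _] := dy.
pose w z := vx z - vy z; have fw : finite_energy w := finite_energyB _ _ fx fy.
have wE f : finite_energy f -> energy_form w f = f x - f y.
  exact: real_dipole_formB dx dy.
(* m has at most the energy of w, and the same pairing with w, because
   w y <= w x; hence the energy of m - w is at most 0. *)
pose m z := Num.max (w z) (w y); rewrite -/(w y) -/(w z).
have [a b|fm le_mw] := contraction_energy_form w m fw.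
  rewrite /m; wlog ba : a b / w b <= w a => [wl|].
    by have [/wl//|/ltW/wl] := leP (w b) (w a); rewrite distrC (distrC (w b)).
  rewrite [leRHS]ger0_norm ?subr_ge0 // ler_norml.
  by case: (leP (w a) (w y)) => ?; case: (leP (w b) (w y)) => ?; lra.
have fmw := finite_energyB _ _ fm fw.
have wxy : w y <= w x by rewrite -subr_ge0 -wE // energy_form_ge0.
have mx : m x = w x by rewrite /m max_l.
have my : m y = w y by rewrite /m maxxx.
have mw0 : energy_form (fun z => m z - w z) (fun z => m z - w z) = 0.
  apply/eqP; rewrite eq_le energy_form_ge0 andbT energy_form_subE //.
  rewrite (energy_formC m) (wE m fm) mx my.
  by move: le_mw; rewrite (wE w fw); lra.
have /eqP := energy_form_eq0 _ fmw mw0 z y.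
rewrite my subrr subr_eq0 => /eqP <-.
by rewrite /m le_max lexx orbT.
Qed.

Lemma real_dipole_triangle x y z vx vy vz :
  real_dipole x vx -> real_dipole y vy -> real_dipole z vz ->
  energy_form (fun s => vx s - vz s) (fun s => vx s - vz s) <=
  energy_form (fun s => vx s - vy s) (fun s => vx s - vy s) +
  energy_form (fun s => vy s - vz s) (fun s => vy s - vz s).
Proof.
move=> dx dy dz; have [fx _ _] := dx; have [fy _ _] := dy; have [fz _ _] := dz.
have fxy := finite_energyB _ _ fx fy; have fzy := finite_energyB _ _ fz fy.
rewrite [X in _ <= _ + X]energy_form_subC.
pose a s := vx s - vy s; pose b s := vz s - vy s.
have -> : energy_form (fun s => vx s - vz s) (fun s => vx s - vz s) =
          energy_form (fun s => a s - b s) (fun s => a s - b s).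
  by apply: eq_energy_form => s t; rewrite /a /b; ring.
rewrite energy_form_subE // gerBl mulr_ge0 // energy_formC.
rewrite (real_dipole_formB z y) // /a subr_ge0.
exact: real_dipole_sub_ge dx dy.
Qed.

Lemma real_dipole_dist_eq0 x y vx vy : real_dipole x vx -> real_dipole y vy ->
  energy_form (fun s => vx s - vy s) (fun s => vx s - vy s) = 0 -> x = y.
Proof.
move=> dx dy; have [fx _ _] := dx; have [fy _ _] := dy.
move=> /(energy_form_eq0 _ (finite_energyB _ _ fx fy)) cst.
pose d s : R := (s == x)%:R.
have fd : finite_energy d by exact: finite_energy_delta.
have := real_dipole_formB x y _ _ d dx dy fd.
rewrite energy_formC (eq_energy_form d d _ (fun=> 0)) //; last first.
  by move=> s t; rewrite (cst s t) !subrr.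
rewrite /energy_form (eq_rsum _ _ (fun=> 0)); last first.
  by move=> p _; rewrite /edge_form; ring.
rewrite rsum_ge0E // esum1 // mulr0 /d eqxx => /esym/eqP.
by case: (eqVneq y x) => [//|_]; rewrite subr0 oner_eq0.
Qed.

(** * Complex dipoles are real dipoles *)

Local Notation rc := (real_complex R).
Local Notation Re := (@complex.Re R).
Local Notation Im := (@complex.Im R).

Lemma sqr_normcE (z : R[i]) :
  Normc.normc z ^+ 2 = Re z ^+ 2 + Im z ^+ 2.
Proof. by case: z => a b /=; rewrite sqr_sqrtr // addr_ge0 ?sqr_ge0. Qed.

Lemma complex_ReB (z1 z2 : R[i]) :
  Re (z1 - z2) = Re z1 - Re z2.
Proof. by case: z1 z2 => [? ?] [? ?]. Qed.

Lemma complex_ImB (z1 z2 : R[i]) :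
  Im (z1 - z2) = Im z1 - Im z2.
Proof. by case: z1 z2 => [? ?] [? ?]. Qed.

Lemma energy_edge_formE (f : V -> R[i]) : energy E c f =
  ((2^-1)%:E * \esum_(p in edges E)
    (edge_form (Re \o f) (Re \o f) p +
     edge_form (Im \o f) (Im \o f) p)%:E)%E.
Proof.
congr (_ * _)%E; apply: eq_esum => p _; congr EFin.
by rewrite sqr_normcE complex_ReB complex_ImB /edge_form /=; ring.
Qed.

Lemma energy_real f : finite_energy f ->
  energy E c (rc \o f) = (energy_form f f)%:E.
Proof.
move=> ff; rewrite energy_edge_formE EFinM rsumE //; last exact: edge_form_ge0.
congr (_ * _)%E; apply: eq_esum => p _; congr EFin.
by rewrite /edge_form /=; ring.
Qed.

Lemma energy_finite_ReIm (f : V -> R[i]) : (energy E c f < +oo)%E ->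
  finite_energy (Re \o f) /\ finite_energy (Im \o f).
Proof.
rewrite energy_edge_formE => fin.
have {}fin : rsummable (edges E) (fun p =>
    edge_form (Re \o f) (Re \o f) p +
    edge_form (Im \o f) (Im \o f) p).
  rewrite rsummable_ge0E; last by move=> p Ep; rewrite addr_ge0 ?edge_form_ge0.
  rewrite ltey; apply: contraTneq fin => ->.
  by rewrite gt0_muley // lte_fin invr_gt0.
split; apply: le_rsummable fin => p Ep;
  by rewrite ger0_norm ?lerDl ?lerDr ?edge_form_ge0.
Qed.

Lemma half_complexE (a b : R) :
  2^-1 * Complex a b = Complex (2^-1 * a) (2^-1 * b).
Proof.
have -> : 2^-1 = rc (2^-1) by rewrite fmorphV rmorph_nat.
by rewrite /real_complex_def; simpc.
Qed.

Lemma energy_inner_reall v (f : V -> R[i]) : energy_inner E c (rc \o v) f =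
  Complex (energy_form v (Re \o f)) (energy_form v (Im \o f)).
Proof.
rewrite /energy_inner half_complexE; congr Complex; congr (_ * _);
  apply: eq_rsum => p _; rewrite /edge_form /=;
  by case: (f p.1) (f p.2) => [a b] [a' b'] /=; ring.
Qed.

Lemma energy_inner_realr (d : V -> R[i]) g :
  finite_energy (Im \o d) -> finite_energy g ->
  energy_inner E c d (rc \o g) =
  Complex (energy_form (Re \o d) g) (- energy_form (Im \o d) g).
Proof.
move=> fd fg; rewrite /energy_inner half_complexE; congr Complex.
  congr (_ * _); apply: eq_rsum => p _; rewrite /edge_form /=.
  by case: (d p.1) (d p.2) => [a b] [a' b'] /=; ring.
rewrite -mulrN -rsumN; last exact: rsummable_edge_form.
congr (_ * _); apply: eq_rsum => p _; rewrite /edge_form /=.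
by case: (d p.1) (d p.2) => [a b] [a' b'] /=; ring.
Qed.

Lemma real_is_dipole x v : real_dipole x v -> is_dipole E c o x (rc \o v).
Proof.
move=> [fv vo vE]; split; first by split; rewrite /= ?vo // energy_real // ltry.
move=> f [fo /energy_finite_ReIm[fRe fIm]].
rewrite energy_inner_reall vE // vE //= .
by case: (f x) (f o) => [? ?] [? ?].
Qed.

(** Testing a complex dipole against real functions shows that its real part is
    a real dipole and that its imaginary part is orthogonal to everything. *)
Lemma dipole_real x v : real_dipole x v -> dipole E c o x = rc \o v.
Proof.
move=> dv; have [fv vo vE] := dv.
have : is_dipole E c o x (dipole E c o x).
  exact: (@xgetI _ _ (is_dipole E c o x) _ (real_is_dipole x v dv)).
set d := dipole _ _ _ _; case=> -[d_o /energy_finite_ReIm[fRe fIm]] dE.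
have dE' g : finite_energy g ->
    energy_form (Re \o d) g = g x - g o /\ energy_form (Im \o d) g = 0.
  move=> fg; pose h y := g y - g o.
  have fh : finite_energy h.
    by apply: eq_rsummable fg => p _; rewrite /edge_form /h; ring.
  have h_in : energy_space E c o (rc \o h).
    by split; rewrite /= ?/h ?subrr // energy_real // ltry.
  have := dE _ h_in; rewrite energy_inner_realr // => dh.
  have eh f : energy_form f h = energy_form f g.
    by apply: eq_energy_form => // y z; rewrite /h; ring.
  have := congr1 Im dh; rewrite complex_ImB /= subrr => /eqP.
  rewrite oppr_eq0 eh => /eqP ->; split=> //.
  by have := congr1 Re dh; rewrite complex_ReB /= eh => ->; rewrite /h; ring.
have Re_d : Re \o d = v.
  apply: (real_dipole_uniq x) => //; split=> //=; first by rewrite d_o.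
  by move=> g /dE'[].
have Im_d y : Im (d y) = 0.
  have [_ Im0] := dE' _ fIm.
  by have /= -> := energy_form_eq0 _ fIm Im0 y o; rewrite d_o.
apply/funext => y; have := Im_d y; rewrite -Re_d /=.
by case: (d y) => a b /= ->.
Qed.

End energy_form.

Theorem corollary4p7 (R : realType) (V : countType) (E : rel V)
    (c : V -> V -> R) (o : V)
    (V_infinite : infinite_set [set: V])
    (E_irreflexive : irreflexive E) (E_symmetric : symmetric E)
    (c_conductance : conductance E c)
    (E_locally_finite : locally_finite E)
    (E_connected : connected_from E o) :
  exists Rc : V -> V -> R,
    [/\ forall x y : V,
          Rc x y
          = energy_norm E c (fun z => dipole E c o x z - dipole E c o y z) ^+ 2,
        is_metric Rc
      & forall x y : V,
          energy_kernel E c o x y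
          = real_complex R ((Rc o x + Rc o y - Rc x y) / 2)].
Proof.
have /choice[v dv] : forall x, exists v, real_dipole E c o x v.
  by move=> x; apply: exists_real_dipole.
have fv x : finite_energy E c (v x) by have [] := dv x.
have vo x : v x o = 0 by have [] := dv x.
have vE x f : finite_energy E c f -> energy_form E c (v x) f = f x - f o.
  by have [_ _] := dv x; apply.
have dipE x : dipole E c o x = real_complex R \o v x by apply: dipole_real.
pose Rc x y :=
  energy_form E c (fun z => v x z - v y z) (fun z => v x z - v y z).
have RcE x y : Rc x y = v x x + v y y - 2 * v x y.
  by rewrite /Rc energy_form_subE // energy_formC !vE // !vo !subr0.
exists Rc; split.
- move=> x y; rewrite !dipE /energy_norm.
  have -> : (fun z => (real_complex R \o v x) z - (real_complex R \o v y) z) =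
            real_complex R \o (fun z => v x z - v y z).
    by apply/funext => z; rewrite /= rmorphB.
  rewrite energy_real //; last exact: finite_energyB.
  by rewrite sqr_sqrtr //=; exact: energy_form_ge0.
- split.
  + by move=> x y; exact: energy_form_ge0.
  + move=> x y; split; last by move=> <-; rewrite RcE; ring.
    exact: real_dipole_dist_eq0 (dv x) (dv y).
  + by move=> x y; exact: energy_form_subC.
  + by move=> x y z; exact: real_dipole_triangle (dv x) (dv y) (dv z).
- move=> x y; rewrite /energy_kernel !dipE.
  have vC : forall s t, v s t = v t s.
    move=> s t; have := vE s (v t) (fv t).
    by rewrite energy_formC vE // !vo !subr0.
  have v_dipole s : is_dipole E c o s (real_complex R \o v s).
    exact: real_is_dipole.
  have [_ ->] := v_dipole x; last by have [] := v_dipole y.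
  rewrite -rmorphB !RcE !(vC o) !vo subr0 (vC y); congr (real_complex R _).
  by field.
Qed.
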